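(* Let $G, H$ be graphs and let $U \subset V(H)$ be a subset of $V(H)$. Then $$I(G[H;U]) = \mathcal{Z}^*_{I(G)}\bigl(I(H), I(H \setminus U)\bigr),$$ where $H \setminus U$ is the graph defined by $V(H \setminus U)=V(H)\setminus U$ and $E(H \setminus U)=\{\{u,v\} \in E(H) : u,v \notin U\}$.
   Context: All graphs are finite and simple: $G=(V(G),E(G))$ with $V(G)$ a finite set and $E(G)\subset\{e\subset V(G) : |e|=2\}$. The independence complex $I(G)$ is the simplicial complex on $V(G)$ whose simplices are the independent sets of $G$, i.e. the sets $\sigma\subset V(G)$ with $\{u,v\}\notin E(G)$ for all $u,v\in\sigma$. For graphs $G,H$ and $U\subset V(H)$, the graph $G[H;U]$ has vertex set $V(G)\times V(H)$, and $\{(u_1,v_1),(u_2,v_2)\}$ is an edge if and only if either $u_1=u_2$ and $\{v_1,v_2\}\in E(H)$, or $\{u_1,u_2\}\in E(G)$ and $v_1,v_2\in U$. The join of a finite family of simplicial complexes $\{K_i\}$ is $\{\sigma\subset\bigsqcup_{i}V(K_i) : \sigma\cap V(K_i)\in K_i \text{ for all } i\}$. For a simplicial complex $M$ with finite vertex set $V(M)$ and a simplicial complex $K$ with a subcomplex $L$, the polyhedral join $\mathcal{Z}^*_M(K,L)$ is the subcomplex $\bigcup_{S\in M}\left(\text{join over } i\in V(M) \text{ of } X^S_i\right)$ of the join of copies of $K$ indexed by $V(M)$, where $X^S_i$ is the $i$-th copy of $K$ if $i\in S$ and the $i$-th copy of $L$ if $i\notin S$. Its vertex set $\bigsqcup_{i\in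 V(M)}V(K)$ is identified with $V(M)\times V(K)$; here, with $V(G)\times V(H)$. *)

(* Defs.v *)
From mathcomp Require Import all_boot.

Set Implicit Arguments.
Unset Strict Implicit.
Unset Printing Implicit Defensive.

(* The vertex set is a finite set inside an ambient finType, so that a graph
   and its vertex deletions live over the same type. *)
Record sgraph (T : finType) := SGraph {
  vertices : {set T};
  edges : {set {set T}};
  edgesP : [forall e in edges, (e \subset vertices) && (#|e| == 2)]
}.

(* Simplices include the empty one, and every vertex is a 0-simplex. *)
Definition is_complex (T : finType) (V : {set T}) (F : {set {set T}}) : bool :=
  [&& set0 \in F,
      [forall v in V, [set v] \in F],
      [forall s in F, s \subset V]
    & [forall s in F, forall t : {set T}, (t \subset s) ==> (t \in F)]].

(* The axioms are boolean, hence proof-irrelevant: two complexes are equal iff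
   they have the same vertices and the same simplices. *)
Record scomplex (T : finType) := SComplex {
  cvertices : {set T};
  simplices : {set {set T}};
  scomplexP : is_complex cvertices simplices
}.

Definition subcomplex (T : finType) (L K : scomplex T) : bool :=
  simplices L \subset simplices K.

Section SComplexFacts.
Variables (T : finType) (K : scomplex T).

Lemma is_complexI (V : {set T}) (F : {set {set T}}) :
  set0 \in F -> (forall v, v \in V -> [set v] \in F) ->
  (forall s, s \in F -> s \subset V) ->
  (forall s t : {set T}, s \in F -> t \subset s -> t \in F) ->
  is_complex V F.
Proof.
move=> F0 F1 FV Fs; rewrite /is_complex F0 /=; apply/and3P; split.
- by apply/forall_inP => v /F1.
- by apply/forall_inP => s /FV.
- by apply/forall_inP => s sF; apply/forall_inP => t /(Fs _ _ sF).
Qed.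

Lemma simplex0 : set0 \in simplices K.
Proof. by case/and4P: (scomplexP K). Qed.

Lemma simplex1 v : v \in cvertices K -> [set v] \in simplices K.
Proof. by case/and4P: (scomplexP K) => _ /forall_inP H _ _ /H. Qed.

Lemma simplex_sub s : s \in simplices K -> s \subset cvertices K.
Proof. by case/and4P: (scomplexP K) => _ _ /forall_inP H _ /H. Qed.

Lemma simplexS (s t : {set T}) :
  s \in simplices K -> t \subset s -> t \in simplices K.
Proof.
by case/and4P: (scomplexP K) => _ _ _ /forall_inP H /H /forall_inP Hs /Hs.
Qed.

End SComplexFacts.

Section IndependenceComplex.
Variables (T : finType) (G : sgraph T).

Definition independent (s : {set T}) : bool :=
  (s \subset vertices G)
    && [forall u in s, forall v in s, [set u; v] \notin edges G].

Lemma edge_loop v : [set v; v] \notin edges G.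
Proof.
apply/negP => /(forall_inP (edgesP G)) /andP[_].
by rewrite setUid cards1.
Qed.

Lemma indep_is_complex : is_complex (vertices G) [set s | independent s].
Proof.
apply: is_complexI => [|v vG|s|s t]; rewrite !inE.
- rewrite /independent sub0set /=.
  by apply/forall_inP => u; rewrite inE.
- rewrite /independent sub1set vG /=.
  apply/forall_inP => u /set1P ->; apply/forall_inP => w /set1P ->.
  exact: edge_loop.
- by case/andP.
- case/andP => sG /forall_inP Hs ts.
  rewrite /independent (subset_trans ts sG) /=.
  apply/forall_inP => u ut; apply/forall_inP => v vt.
  by move/forall_inP: (Hs u (subsetP ts _ ut)); apply; apply: (subsetP ts).
Qed.

Definition indep_complex : scomplex T := SComplex indep_is_complex.

End IndependenceComplex.

Section VertexDeletion.
Variables (T : finType) (H : sgraph T) (U : {set T}).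

Definition delete_edges : {set {set T}} :=
  [set e in edges H | [forall u in e, u \notin U]].

Lemma delete_edgesP :
  [forall e in delete_edges, (e \subset vertices H :\: U) && (#|e| == 2)].
Proof.
apply/forall_inP => e; rewrite inE => /andP[eH /forall_inP eU].
case/andP: (forall_inP (edgesP H) e eH) => eV ->; rewrite andbT.
by apply/subsetP => u ue; rewrite inE (eU _ ue) (subsetP eV).
Qed.

Definition delete : sgraph T := SGraph delete_edgesP.

Lemma indep_delete_sub : subcomplex (indep_complex delete) (indep_complex H).
Proof.
apply/subsetP => s; rewrite !inE => /andP[sV /forall_inP Hs].
have sVU u : u \in s -> (u \notin U) /\ (u \in vertices H).
  by move/(subsetP sV); rewrite inE => /andP[].
apply/andP; split; first by apply/subsetP => u /sVU[].
apply/forall_inP => u us; apply/forall_inP => v vs.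
move/forall_inP: (Hs u us) => /(_ v vs); apply: contra => uvH.
rewrite inE uvH; apply/forall_inP => w.
by rewrite !inE => /orP[] /eqP ->; [case: (sVU u us) | case: (sVU v vs)].
Qed.

End VertexDeletion.

(* Written G[H;U]; for U = V(H) it is the lexicographic product of G and H. *)
Section GraphProduct.
Variables (A B : finType) (G : sgraph A) (H : sgraph B) (U : {set B}).

Definition prod_adj (p q : A * B) : bool :=
  (p.1 == q.1) && ([set p.2; q.2] \in edges H)
  || [&& [set p.1; q.1] \in edges G, p.2 \in U & q.2 \in U].

Definition prod_edges : {set {set A * B}} :=
  [set [set p; q] | p in setX (vertices G) (vertices H),
                    q in setX (vertices G) (vertices H) & prod_adj p q].

Lemma prod_edgesP :
  [forall e in prod_edges,
     (e \subset setX (vertices G) (vertices H)) && (#|e| == 2)].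
Proof.
apply/forall_inP => e /imset2P[p q pV]; rewrite inE => /andP[qV pq] ->.
rewrite subUset !sub1set pV qV /= cards2.
suff -> : p != q by [].
apply: contraTneq pq => ->; rewrite /prod_adj.
by rewrite !(negbTE (edge_loop _ _)) andbF.
Qed.

Definition graph_prod : sgraph (A * B)%type := SGraph prod_edgesP.

End GraphProduct.

(* Join of the family (K i), i in I.  The disjoint union of the vertex sets is
   the set of pairs (i, v) with i in I and v a vertex of K i. *)
Section Join.
Variables (A B : finType) (I : {set A}) (K : A -> scomplex B).

Definition join_vertices : {set A * B} :=
  [set p | (p.1 \in I) && (p.2 \in cvertices (K p.1))].

(* The intersection of s with the i-th summand, as a set of vertices of K i. *)
Definition fiber (s : {set A * B}) (i : A) : {set B} :=
  [set v | (i, v) \in s].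

Definition join_simplices : {set {set A * B}} :=
  [set s : {set A * B} | (s \subset join_vertices)
     && [forall i in I, fiber s i \in simplices (K i)]].

Lemma join_is_complex : is_complex join_vertices join_simplices.
Proof.
apply: is_complexI => [|[i v]|s|s t]; rewrite !inE.
- rewrite sub0set; apply/forall_inP => i _.
  suff -> : fiber set0 i = set0 by exact: simplex0.
  by apply/setP => v; rewrite !inE.
- move=> /= /andP[iI vK]; rewrite sub1set inE /= iI vK /=.
  apply/forall_inP => j _; case: (eqVneq j i) => [-> | ji].
    suff -> : fiber [set (i, v)] i = [set v] by exact: simplex1.
    by apply/setP => w; rewrite !inE xpair_eqE eqxx.
  suff -> : fiber [set (i, v)] j = set0 by exact: simplex0.
  by apply/setP => w; rewrite !inE xpair_eqE (negbTE ji).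
- by case/andP.
- case/andP => sV /forall_inP Hs ts; rewrite (subset_trans ts sV) /=.
  apply/forall_inP => i /Hs Hi; apply: simplexS Hi _.
  by apply/subsetP => v; rewrite !inE => /(subsetP ts).
Qed.

Definition join_complex : scomplex (A * B)%type := SComplex join_is_complex.

End Join.

Section PolyhedralJoin.
Variables (A B : finType) (M : scomplex A) (K L : scomplex B).

Definition polyjoin_simplices : {set {set A * B}} :=
  \bigcup_(S in simplices M)
    simplices (join_complex (cvertices M) (fun i => if i \in S then K else L)).

Lemma polyjoin_is_complex : subcomplex L K ->
  is_complex (setX (cvertices M) (cvertices K)) polyjoin_simplices.
Proof.
move=> LK; apply: is_complexI => [|[i v]|s|s t].
- apply/bigcupP; exists set0; exact: simplex0.
- rewrite in_setX => /andP[iM vK]; apply/bigcupP; exists [set i].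
    exact: simplex1.
  by apply: simplex1; rewrite inE /= iM set11.
- case/bigcupP => S _ /simplex_sub sV; apply: subset_trans sV _.
  apply/subsetP => -[i v]; rewrite in_setX inE /= => /andP[-> ] /=.
  case: ifP => // _ /simplex1 /(subsetP LK) /simplex_sub.
  by rewrite sub1set.
- case/bigcupP => S SM sS ts; apply/bigcupP; exists S => //.
  exact: simplexS sS ts.
Qed.

Definition polyjoin (LK : subcomplex L K) : scomplex (A * B)%type :=
  SComplex (polyjoin_is_complex LK).

End PolyhedralJoin.

Arguments polyjoin {A B} M K L LK.

(* Main.v *)
Require Import Defs.
From mathcomp Require Import all_boot.

(** A set [s] of vertices of [G[H;U]] is independent iff each of its fibers is
independent in [H] and the set of [i] whose fiber meets [U] is independent in
[G].  That set is the simplex of [I(G)] witnessing that [s] lies in the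
polyhedral join; conversely any witnessing simplex contains it, because the
fibers outside the witness avoid [U]. *)

Lemma eq_scomplex (T : finType) (K L : scomplex T) :
  cvertices K = cvertices L -> simplices K = simplices L -> K = L.
Proof.
case: K L => [V F KP] [W E LP] /= eqV eqF.
case: _ / eqV in LP *; case: _ / eqF in LP *.
by congr SComplex; apply: bool_irrelevance.
Qed.

Lemma independentP (T : finType) (G : sgraph T) (s : {set T}) :
  reflect (s \subset vertices G /\
           forall u v, u \in s -> v \in s -> [set u; v] \notin edges G)
          (independent G s).
Proof.
apply: (iffP andP) => -[sV sI]; split=> //.
  by move=> u v us vs; apply: (forall_inP (forall_inP sI u us)).
by apply/forall_inP => u us; apply/forall_inP => v vs; apply: sI.
Qed.

Arguments independentP {T G s}.

(** Deletion removes only edges meeting [U], so among sets avoiding [U] independence is unchanged.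
    This lets both kinds of factor of the polyhedral join be described inside [H]. *)
Lemma independent_delete (T : finType) (H : sgraph T) (U s : {set T}) :
  independent (delete H U) s = independent H s && [disjoint s & U].
Proof.
apply/idP/andP => [sHU | [/independentP[sV sI] sU]].
  split; first by have /subsetP/(_ s) := indep_delete_sub H U; rewrite !inE; exact.
  by case/independentP: sHU; rewrite /= subsetD => /andP[].
apply/independentP; split=> [|u v us vs]; first by rewrite /= subsetD sV.
by rewrite inE negb_and sI.
Qed.

Lemma prod_adjC (A B : finType) (G : sgraph A) (H : sgraph B) (U : {set B})
    (p q : A * B) : prod_adj G H U p q = prod_adj G H U q p.
Proof.
by rewrite /prod_adj eq_sym [[set p.2; _]]setUC [[set p.1; _]]setUC
           [(p.2 \in U) && _]andbC.
Qed.

Lemma set2_eq (T : finType) (a b c d : T) :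
  [set a; b] = [set c; d] -> (a = c /\ b = d) \/ (a = d /\ b = c).
Proof.
move=> E.
have /set2P aE : a \in [set c; d] by rewrite -E set21.
have /set2P bE : b \in [set c; d] by rewrite -E set22.
have /set2P cE : c \in [set a; b] by rewrite E set21.
have /set2P dE : d \in [set a; b] by rewrite E set22.
by case: aE bE cE dE => -> [] -> [] ? [] ?; auto.
Qed.

(** An edge determines its endpoints only up to order, which the symmetry of [prod_adj] absorbs. *)
Lemma prod_edgeE (A B : finType) (G : sgraph A) (H : sgraph B) (U : {set B})
    (p q : A * B) :
  p \in setX (vertices G) (vertices H) ->
  q \in setX (vertices G) (vertices H) ->
  ([set p; q] \in edges (graph_prod G H U)) = prod_adj G H U p q.
Proof.
move=> pV qV; apply/imset2P/idP => [[p' q' _] | pq]; last first.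
  by exists p q; rewrite // inE qV.
by rewrite inE => /andP[_ pq] /set2_eq[] [-> ->] //; rewrite prod_adjC.
Qed.

(** The two disjuncts of [prod_adj] separate: the first sees one fiber at a time, the second only
    which fibers meet [U]. *)
Lemma independent_prod (A B : finType) (G : sgraph A) (H : sgraph B)
    (U : {set B}) (s : {set A * B}) :
  reflect [/\ s \subset setX (vertices G) (vertices H),
              forall i, independent H (fiber s i)
            & independent G [set i | ~~ [disjoint fiber s i & U]]]
          (independent (graph_prod G H U) s).
Proof.
apply: (iffP independentP) => [[/= sV sI] | [sV sH sG]].
  have nadj p q : p \in s -> q \in s -> ~~ prod_adj G H U p q.
    by move=> ps qs; rewrite -prod_edgeE ?(subsetP sV) // sI.
  split=> // [i|]; apply/independentP; split.
  - by apply/subsetP => v; rewrite inE => /(subsetP sV); rewrite in_setX => /andP[].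
  - move=> u v; rewrite !inE => us vs.
    by apply: contra (nadj _ _ us vs); rewrite /prod_adj /= eqxx => ->.
  - apply/subsetP => i; rewrite inE => /pred0Pn[v /andP[]] /=.
    by rewrite inE => /(subsetP sV); rewrite in_setX => /andP[].
  (* Points [u] and [v] of [U] in the two fibers would lift an edge of [G] to an edge of the product
     inside [s]. *)
  - move=> i j; rewrite !inE => /pred0Pn[u /andP[/= + uU]] /pred0Pn[v /andP[/= + vU]].
    rewrite !inE => us vs; apply: contra (nadj _ _ us vs) => ij.
    by rewrite /prod_adj /= ij uU vU orbT.
split=> // -[i u] [j v] us vs; rewrite prod_edgeE ?(subsetP sV) //.
rewrite /prod_adj /= negb_or; apply/andP; split.
  case: eqVneq => //= ij; rewrite -{j}ij in vs.
  by case/independentP: (sH i) => _; apply; rewrite inE.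
apply/and3P => -[ij uU vU].
have [_ /(_ i j)] := independentP sG; rewrite ij => sGij.
suff: false by []; apply: sGij; rewrite inE; apply/pred0Pn.
  by exists u; rewrite /= inE us.
by exists v; rewrite /= inE vs.
Qed.

Theorem proposition5p4 (A B : finType) (G : sgraph A) (H : sgraph B)
    (U : {set B}) (hU : U \subset vertices H) :
  indep_complex (graph_prod G H U)
  = polyjoin (indep_complex G) (indep_complex H) (indep_complex (delete H U))
      (indep_delete_sub H U).
Proof.
apply: eq_scomplex => //=; apply/setP => s; rewrite inE.
(* Used with [b] equal to [i \in S]: outside [S] the factor adds only the condition of avoiding
   [U]. *)
have simplE (b : bool) t :
  (t \in simplices (if b then indep_complex H else indep_complex (delete H U)))
  = independent H t && (~~ b ==> [disjoint t & U]).
  by case: b; rewrite /= inE ?andbT ?independent_delete.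
apply/independent_prod/bigcupP => [[sV sH sG] | [S /[!inE] SG /andP[sV /forall_inP sS]]].
  exists [set i | ~~ [disjoint fiber s i & U]]; first by rewrite inE.
  rewrite inE; apply/andP; split; last first.
    by apply/forall_inP => i _; rewrite simplE sH inE negbK implybb.
  (* The vertex set of the join depends on the witness too: over [i] outside it, [v] must avoid
     [U]. *)
  apply/subsetP => -[i v] ivs; have := subsetP sV _ ivs.
  rewrite in_setX inE => /andP[-> vH] /=; case: ifP => //=.
  by rewrite !inE vH andbT => /negbFE/disjointFr->//; rewrite inE.
have sX : s \subset setX (vertices G) (vertices H).
  apply: subset_trans sV _; apply/subsetP => -[i v].
  rewrite in_setX inE /= => /andP[-> ]; case: ifP => //= _.
  by rewrite inE => /andP[].
have fiberG i v : v \in fiber s i -> i \in vertices G.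
  by rewrite inE => /(subsetP sX); rewrite in_setX => /andP[].
split=> // [i|].
  have [iG | iNG] := boolP (i \in vertices G).
    by have := sS i iG; rewrite simplE => /andP[].
  (* The join constrains only fibers over vertices of [G]; all others are empty. *)
  suff -> : fiber s i = set0 by have := simplex0 (indep_complex H); rewrite inE.
  by apply/setP => v; rewrite in_set0; apply: contraNF iNG => /fiberG.
suff: [set i | ~~ [disjoint fiber s i & U]] \in simplices (indep_complex G).
  by rewrite inE.
(* Simplices are closed under subsets, so inclusion in [S] suffices. *)
apply: (@simplexS _ _ S); first by rewrite inE.
apply/subsetP => i; rewrite inE => sU.
have /pred0Pn[v /andP[/fiberG iG _]] := sU.
have := sS i iG; rewrite simplE => /andP[_].
by rewrite implybE negbK (negbTE sU) orbF.
Qed.
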